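(* Write any vector $\vec{\zeta}\in\mathbb{BC}^n$ as $\vec{\zeta}=\vec{\zeta}_1\mathbf{e}_1+\vec{\zeta}_2\mathbf{e}_2$ with $\vec{\zeta}_1,\vec{\zeta}_2\in\mathbb{C}^n$, and decompose any given subspace $S\subseteq\mathbb{BC}^n$ as $S=S_1\mathbf{e}_1\oplus S_2\mathbf{e}_2$, where $S_1$ and $S_2$ are subspaces of $\mathbb{C}^n$. Then $S$ is invariant under any given $n\times n$ bicomplex matrix $A=A_1\mathbf{e}_1+A_2\mathbf{e}_2$ if and only if $S_1$ is invariant under $A_1$ and $S_2$ is invariant under $A_2$.
   Context: The bicomplex numbers $\mathbb{BC}$ are the elements $\zeta=z_1+jz_2$ with $z_1,z_2\in\mathbb{C}$, $i^2=j^2=-1$, $ij=ji$; they form a commutative ring. Put $\mathbf{e}_1=(1+ij)/2$ and $\mathbf{e}_2=(1-ij)/2$; then $\mathbf{e}_1^2=\mathbf{e}_1$, $\mathbf{e}_2^2=\mathbf{e}_2$, $\mathbf{e}_1\mathbf{e}_2=0$. Every $\zeta\in\mathbb{BC}$ has a unique idempotent representation $\zeta=\zeta_1\mathbf{e}_1+\zeta_2\mathbf{e}_2$ with $\zeta_1,\zeta_2\in\mathbb{C}$; applied entrywise, this gives $A=A_1\mathbf{e}_1+A_2\mathbf{e}_2$ with $A_1,A_2$ complex $n\times n$ matrices for a bicomplex $n\times n$ matrix $A$. $\mathbb{BC}^n$ is the set of $n$-dimensional column vectors with bicomplex entries; subspaces of it are taken over the bicomplex scalars. The notation $S=S_1\mathbf{e}_1\oplus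 S_2\mathbf{e}_2$ means $S=\{s_1\mathbf{e}_1+s_2\mathbf{e}_2: s_1\in S_1, s_2\in S_2\}$. A subspace $S$ is invariant under $A$ when $A\vec{\zeta}\in S$ for every $\vec{\zeta}\in S$ (and likewise for complex matrices and subspaces of $\mathbb{C}^n$). *)

(* Defs.v *)
From HB Require Import structures.
From mathcomp Require Import all_boot all_order all_algebra.
From mathcomp Require Import boolp classical_sets reals.
From mathcomp Require Import complex.
From mathcomp Require Import ring.

Set Implicit Arguments.
Unset Strict Implicit.
Unset Printing Implicit Defensive.

Import Order.TTheory GRing.Theory Num.Theory.

Local Open Scope classical_set_scope.
Local Open Scope ring_scope.

(* The complex field is R[i] for an arbitrary R : realType;
   Bicomplex z1 z2 stands for z1 + j z2. *)
Record bicomplex (R : realType) := Bicomplex { bc1 : R[i]; bc2 : R[i] }.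

Section BicomplexRing.
Variable R : realType.
Local Notation BC := (bicomplex R).

Definition pair_of_bicomplex (x : BC) : R[i] * R[i] := (bc1 x, bc2 x).
Definition bicomplex_of_pair (p : R[i] * R[i]) : BC := Bicomplex p.1 p.2.

Lemma pair_of_bicomplexK : cancel pair_of_bicomplex bicomplex_of_pair.
Proof. by case. Qed.

HB.instance Definition _ := Choice.copy BC (can_type pair_of_bicomplexK).

Definition bc_zero : BC := Bicomplex 0 0.
Definition bc_one : BC := Bicomplex 1 0.
Definition bc_opp (x : BC) : BC := Bicomplex (- bc1 x) (- bc2 x).
Definition bc_add (x y : BC) : BC :=
  Bicomplex (bc1 x + bc1 y) (bc2 x + bc2 y).
Definition bc_mul (x y : BC) : BC :=
  Bicomplex (bc1 x * bc1 y - bc2 x * bc2 y) (bc1 x * bc2 y + bc2 x * bc1 y).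

Fact bc_addA : associative bc_add.
Proof. by case=> ? ? [? ?] [? ?]; congr Bicomplex; rewrite /= addrA. Qed.
Fact bc_addC : commutative bc_add.
Proof. by case=> ? ? [? ?]; congr Bicomplex; rewrite /= addrC. Qed.
Fact bc_add0 : left_id bc_zero bc_add.
Proof. by case=> ? ?; congr Bicomplex; rewrite /= add0r. Qed.
Fact bc_addN : left_inverse bc_zero bc_opp bc_add.
Proof. by case=> ? ?; congr Bicomplex; rewrite /= addNr. Qed.

HB.instance Definition _ :=
  GRing.isZmodule.Build BC bc_addA bc_addC bc_add0 bc_addN.

Fact bc_mulA : associative bc_mul.
Proof. by case=> ? ? [? ?] [? ?]; congr Bicomplex => /=; ring. Qed.
Fact bc_mulC : commutative bc_mul.
Proof. by case=> ? ? [? ?]; congr Bicomplex => /=; ring. Qed.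
Fact bc_mul1 : left_id bc_one bc_mul.
Proof. by case=> ? ?; congr Bicomplex => /=; ring. Qed.
Fact bc_mulDl : left_distributive bc_mul bc_add.
Proof. by case=> ? ? [? ?] [? ?]; congr Bicomplex => /=; ring. Qed.
Fact bc_one_neq0 : bc_one != bc_zero.
Proof. by apply/eqP => -[] /eqP; rewrite oner_eq0. Qed.

HB.instance Definition _ := GRing.Zmodule_isComNzRing.Build BC
  bc_mulA bc_mulC bc_mul1 bc_mulDl bc_one_neq0.

Definition bc_of_complex (z : R[i]) : BC := Bicomplex z 0.

Definition bc_i : BC := bc_of_complex 'i%C.
Definition bc_j : BC := Bicomplex 0 1.

Definition e1 : BC := bc_of_complex 2^-1 * (1 + bc_i * bc_j).
Definition e2 : BC := bc_of_complex 2^-1 * (1 - bc_i * bc_j).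

(* M1 e1 + M2 e2, entrywise; column vectors are the case n = 1. *)
Definition idem_comb (m n : nat) (M1 M2 : 'M[R[i]]_(m, n)) : 'M[BC]_(m, n) :=
  e1 *: map_mx bc_of_complex M1 + e2 *: map_mx bc_of_complex M2.

Definition idem_dsum (n : nat) (S1 S2 : set 'cV[R[i]]_n) : set 'cV[BC]_n :=
  [set idem_comb s1 s2 | s1 in S1 & s2 in S2].

End BicomplexRing.

Arguments e1 {R}.
Arguments e2 {R}.

(* Over the bicomplex ring, which is not a field, a subspace is a submodule. *)
Definition is_subspace (K : nzRingType) (n : nat) (S : set 'cV[K]_n) : Prop :=
  submod_closed (mem S).

Definition mx_invariant (K : nzRingType) (n : nat)
    (A : 'M[K]_n) (S : set 'cV[K]_n) : Prop :=
  forall v : 'cV[K]_n, S v -> S (A *m v).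

Section IdempotentRepresentation.
Variable R : realType.
Local Notation BC := (bicomplex R).

Lemma bc_of_complex_is_zmod_morphism : zmod_morphism (@bc_of_complex R).
Proof. by move=> x y; congr Bicomplex; rewrite /= ?oppr0 ?addr0. Qed.
Lemma bc_of_complex_is_monoid_morphism : monoid_morphism (@bc_of_complex R).
Proof. by split=> // x y; congr Bicomplex => /=; ring. Qed.
HB.instance Definition _ := GRing.isZmodMorphism.Build R[i] BC
  (@bc_of_complex R) bc_of_complex_is_zmod_morphism.
HB.instance Definition _ := GRing.isMonoidMorphism.Build R[i] BC
  (@bc_of_complex R) bc_of_complex_is_monoid_morphism.

Lemma bc_i_sq : bc_i R * bc_i R = -1.
Proof.
rewrite -rmorphM /= -[LHS]/(bc_of_complex ('i%C ^+ 2)) sqr_i.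
by rewrite rmorphN rmorph1.
Qed.

Lemma bc_j_sq : bc_j R * bc_j R = -1.
Proof. by congr Bicomplex => /=; ring. Qed.

Lemma bicomplexE (x : BC) :
  x = bc_of_complex (bc1 x) + bc_j R * bc_of_complex (bc2 x).
Proof. by case: x => a b; congr Bicomplex => /=; ring. Qed.

Lemma e1E : e1 = Bicomplex 2^-1 (2^-1 * 'i%C) :> BC.
Proof. by congr Bicomplex => /=; ring. Qed.
Lemma e2E : e2 = Bicomplex 2^-1 (- (2^-1 * 'i%C)) :> BC.
Proof. by congr Bicomplex => /=; ring. Qed.

Lemma e1_idem : e1 * e1 = e1 :> BC.
Proof.
have i2 : ('i%C : R[i]) ^+ 2 = -1 by exact: sqr_i.
by rewrite e1E; congr Bicomplex => /=; field: i2.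
Qed.
Lemma e2_idem : e2 * e2 = e2 :> BC.
Proof.
have i2 : ('i%C : R[i]) ^+ 2 = -1 by exact: sqr_i.
by rewrite e2E; congr Bicomplex => /=; field: i2.
Qed.
Lemma e1_mul_e2 : e1 * e2 = 0 :> BC.
Proof.
have i2 : ('i%C : R[i]) ^+ 2 = -1 by exact: sqr_i.
by rewrite e1E e2E; congr Bicomplex => /=; field: i2.
Qed.

Lemma idem_comb_exists (m n : nat) (M : 'M[BC]_(m, n)) :
  exists M1 M2 : 'M[R[i]]_(m, n), M = idem_comb M1 M2.
Proof.
have i2 : ('i%C : R[i]) ^+ 2 = -1 by exact: sqr_i.
exists (map_mx (fun x => bc1 x - 'i%C * bc2 x) M).
exists (map_mx (fun x => bc1 x + 'i%C * bc2 x) M).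
apply/matrixP => k l; rewrite !mxE e1E e2E.
by case: (M k l) => a b; congr Bicomplex => /=; field: i2.
Qed.

Lemma idem_comb_inj (m n : nat) (M1 M2 N1 N2 : 'M[R[i]]_(m, n)) :
  idem_comb M1 M2 = idem_comb N1 N2 -> M1 = N1 /\ M2 = N2.
Proof.
have i2 : ('i%C : R[i]) ^+ 2 = -1 by exact: sqr_i.
have fst_comb (P Q : 'M[R[i]]_(m, n)) k l :
    bc1 (idem_comb P Q k l) - 'i%C * bc2 (idem_comb P Q k l) = P k l.
  by rewrite !mxE e1E e2E /=; field: i2.
have snd_comb (P Q : 'M[R[i]]_(m, n)) k l :
    bc1 (idem_comb P Q k l) + 'i%C * bc2 (idem_comb P Q k l) = Q k l.
  by rewrite !mxE e1E e2E /=; field: i2.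
move=> eqMN; split; apply/matrixP => k l.
  by rewrite -(fst_comb M1 M2) eqMN fst_comb.
by rewrite -(snd_comb M1 M2) eqMN snd_comb.
Qed.

End IdempotentRepresentation.

(* Main.v *)
Require Import Defs.
From mathcomp Require Import all_boot all_order all_algebra.
From mathcomp Require Import boolp classical_sets reals.
From mathcomp Require Import complex.

Import GRing.Theory.

Local Open Scope classical_set_scope.
Local Open Scope ring_scope.

(** Since [e1] and [e2] are orthogonal idempotents, matrices over the
    bicomplex numbers are computed componentwise: sums, complex multiples and
    products of matrices [M1 e1 + M2 e2] act separately on the two complex
    components ([idem_combD], [idem_combZ], [idem_comb_mulmx]).

    The decomposition of a subspace [S] exists because [S] is stable under
    the scalars [e1] and [e2] themselves: multiplying [v1 e1 + v2 e2] by [e1]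
    or [e2] isolates [v1 e1] or [v2 e2] inside [S].  So one takes for [S1]
    the vectors [v] with [v e1] in [S], and for [S2] those with [v e2] in
    [S] ([idem_dsum_slices]).

    The invariance criterion follows from uniqueness of the components, by
    which [v1 e1 + v2 e2] lies in [S1 e1 + S2 e2] exactly when [v1] is in [S1]
    and [v2] is in [S2] ([mem_idem_dsum]), and from the product rule
    [A (v1 e1 + v2 e2) = (A1 v1) e1 + (A2 v2) e2].  To recover the invariance
    of one component from that of [S], the rule is applied to vectors whose
    other component is [0]. *)

Lemma is_subspaceP (K : nzRingType) (n : nat) (S : set 'cV[K]_n) :
  is_subspace S <->
  S 0 /\ (forall a u v, S u -> S v -> S (a *: u + v)).
Proof.
rewrite /is_subspace /submod_closed; split=> -[S0 Slin].
  split=> [|a u v Su Sv]; first exact: (set_mem S0).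
  by apply: set_mem; apply: Slin; apply: mem_set.
split=> [|a u v /set_mem Su /set_mem Sv]; apply: mem_set => //.
exact: Slin.
Qed.

Section IdempotentCalculus.
Context {R : realType}.

Lemma e2_mul_e1 : e2 * e1 = 0 :> bicomplex R.
Proof. by rewrite mulrC e1_mul_e2. Qed.

Lemma idem_combD (m n : nat) (M1 M2 N1 N2 : 'M[R[i]]_(m, n)) :
  idem_comb M1 M2 + idem_comb N1 N2 = idem_comb (M1 + N1) (M2 + N2).
Proof. by rewrite /idem_comb !map_mxD !scalerDr addrACA. Qed.

Lemma idem_combZ (m n : nat) (a : R[i]) (M1 M2 : 'M[R[i]]_(m, n)) :
  bc_of_complex a *: idem_comb M1 M2 = idem_comb (a *: M1) (a *: M2).
Proof.
by rewrite /idem_comb !map_mxZ scalerDr !scalerA ![bc_of_complex a * _]mulrC.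
Qed.

Lemma e1_scale_idem_comb (m n : nat) (M1 M2 : 'M[R[i]]_(m, n)) :
  e1 *: idem_comb M1 M2 = idem_comb M1 0.
Proof.
by rewrite /idem_comb scalerDr !scalerA e1_idem e1_mul_e2 scale0r map_mx0
           scaler0.
Qed.

Lemma e2_scale_idem_comb (m n : nat) (M1 M2 : 'M[R[i]]_(m, n)) :
  e2 *: idem_comb M1 M2 = idem_comb 0 M2.
Proof.
by rewrite /idem_comb scalerDr !scalerA e2_idem e2_mul_e1 scale0r map_mx0
           scaler0.
Qed.

Lemma idem_comb0 (m n : nat) : idem_comb (0 : 'M[R[i]]_(m, n)) 0 = 0.
Proof. by rewrite /idem_comb map_mx0 !scaler0 addr0. Qed.

(** The cross terms carry the factor [e1 * e2 = 0]. *)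
Lemma idem_comb_mulmx (m n p : nat)
    (A1 A2 : 'M[R[i]]_(m, n)) (B1 B2 : 'M[R[i]]_(n, p)) :
  idem_comb A1 A2 *m idem_comb B1 B2 = idem_comb (A1 *m B1) (A2 *m B2).
Proof.
rewrite /idem_comb mulmxDl !mulmxDr -!scalemxAl -!scalemxAr !scalerA.
by rewrite e1_idem e2_idem e1_mul_e2 e2_mul_e1 !scale0r addr0 add0r !map_mxM.
Qed.

(** The witnesses in [idem_dsum] can only be [v1] and [v2] themselves, because
    the idempotent representation is unique. *)
Lemma mem_idem_dsum (n : nat) (S1 S2 : set 'cV[R[i]]_n) (v1 v2 : 'cV[R[i]]_n) :
  idem_dsum S1 S2 (idem_comb v1 v2) <-> S1 v1 /\ S2 v2.
Proof.
split=> [[s1 S1s1 [s2 S2s2 /idem_comb_inj [<- <-]]] //|[S1v1 S2v2]].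
by exists v1 => //; exists v2.
Qed.

Section Slices.
Variables (n : nat) (S : set 'cV[bicomplex R]_n).
Hypothesis subS : is_subspace S.

Definition slice1 : set 'cV[R[i]]_n := [set v | S (idem_comb v 0)].
Definition slice2 : set 'cV[R[i]]_n := [set v | S (idem_comb 0 v)].

Lemma slice1_subspace : is_subspace slice1.
Proof.
have [S0 Slin] := (is_subspaceP _ _ S).1 subS.
apply/is_subspaceP; rewrite /slice1 /=; split=> [|a u v Su Sv].
  by rewrite idem_comb0.
by have := Slin (bc_of_complex a) _ _ Su Sv; rewrite idem_combZ idem_combD
  scaler0 addr0.
Qed.

Lemma slice2_subspace : is_subspace slice2.
Proof.
have [S0 Slin] := (is_subspaceP _ _ S).1 subS.
apply/is_subspaceP; rewrite /slice2 /=; split=> [|a u v Su Sv].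
  by rewrite idem_comb0.
by have := Slin (bc_of_complex a) _ _ Su Sv; rewrite idem_combZ idem_combD
  scaler0 addr0.
Qed.

(** Complex linearity of [S] alone would not give this equality: it rests on
    the stability of [S] under the scalars [e1] and [e2]. *)
Lemma idem_dsum_slices : S = idem_dsum slice1 slice2.
Proof.
have [S0 Slin] := (is_subspaceP _ _ S).1 subS.
have SZ a u : S u -> S (a *: u).
  by move=> Su; rewrite -[a *: u]addr0; apply: Slin.
apply/seteqP; split=> v; have [v1 [v2 ->]] := idem_comb_exists v.
  move=> Sv; apply/mem_idem_dsum; rewrite /slice1 /slice2 /=; split.
    by rewrite -(e1_scale_idem_comb _ _ v1 v2); apply: SZ.
  by rewrite -(e2_scale_idem_comb _ _ v1 v2); apply: SZ.
move=> /mem_idem_dsum [Sv1 Sv2].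
by have := Slin 1 _ _ Sv1 Sv2; rewrite scale1r idem_combD addr0 add0r.
Qed.

End Slices.

(** Membership of [0] in [S1] and [S2] rules out an empty summand: it would make
    the whole sum empty, and so invariant whatever the other summand is. *)
Lemma mx_invariant_idem_dsum (n : nat) (S1 S2 : set 'cV[R[i]]_n)
    (A1 A2 : 'M[R[i]]_n) : S1 0 -> S2 0 ->
  mx_invariant (idem_comb A1 A2) (idem_dsum S1 S2) <->
  mx_invariant A1 S1 /\ mx_invariant A2 S2.
Proof.
move=> S10 S20; split=> [invA|[invA1 invA2] v].
  have invA12 v1 v2 : S1 v1 -> S2 v2 -> S1 (A1 *m v1) /\ S2 (A2 *m v2).
    move=> S1v1 S2v2; apply/mem_idem_dsum; rewrite -idem_comb_mulmx.
    by apply: invA; apply/mem_idem_dsum.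
  split=> v Sv; first by have [] := invA12 v 0 Sv S20.
  by have [] := invA12 0 v S10 Sv.
have [v1 [v2 ->]] := idem_comb_exists v.
rewrite idem_comb_mulmx => /mem_idem_dsum [S1v1 S2v2].
by apply/mem_idem_dsum; split; [apply: invA1 | apply: invA2].
Qed.

End IdempotentCalculus.

Theorem corollary4 (R : realType) (n : nat)
    (S : set 'cV[bicomplex R]_n) (hS : is_subspace S) :
  (exists S1 S2 : set 'cV[R[i]]_n,
     [/\ is_subspace S1, is_subspace S2 & S = idem_dsum S1 S2]) /\
  (forall S1 S2 : set 'cV[R[i]]_n,
     is_subspace S1 -> is_subspace S2 -> S = idem_dsum S1 S2 ->
     forall (A : 'M[bicomplex R]_n) (A1 A2 : 'M[R[i]]_n),
       A = idem_comb A1 A2 ->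
       (mx_invariant A S <-> mx_invariant A1 S1 /\ mx_invariant A2 S2)).
Proof.
split.
  exists (slice1 n S), (slice2 n S).
  split; [exact: slice1_subspace | exact: slice2_subspace |].
  exact: idem_dsum_slices.
move=> S1 S2 /is_subspaceP [S10 _] /is_subspaceP [S20 _] -> A A1 A2 ->.
exact: mx_invariant_idem_dsum.
Qed.
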